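(* Let $d,n\ge2$, $\beta>0$, $r\in\{1,\ldots,d-1\}$, $\mathcal X=\{0,1,\ldots,n-1\}^d$, and $\partial_r=\{x\in\mathcal X:r+1\le\rho(x)\le d\}$. For $m>0$ let $(g_x)_{x\in\mathcal X}$ be the Gaussian free field with distance-independent interaction and boundary $\partial_r$, as defined in the context. Then for $(x,x')\in(\mathcal X\setminus\partial_r)\times(\mathcal X\setminus\partial_r)$, $$\lim_{m\to0}\mathrm{Cov}(g_x,g_{x'})=\frac1\beta\left(\delta_{x,x'}+\frac1{|\partial_r|}\right).$$ Consequently, for $x\ne x'$, $\lim_{m\to0}\mathrm{Corr}(g_x,g_{x'})=1/(1+|\partial_r|)$, which is strictly decreasing in the boundary size $|\partial_r|$.
   Context: $\rho(x)=|\{i:x_i\ne0\}|$ is the Hamming distance of $x$ from the origin. Let $\mathcal Y=\mathcal X\setminus\partial_r$. The Hamiltonian is $$H_{\mathcal Y}\{(\xi_x)_{x\in\mathcal X}\}=\frac1{4n^d}\sum_{x,x'\in\mathcal X}(\xi_x-\xi_{x'})^2+\frac{m^2}2\sum_{x\in\mathcal Y}\xi_x^2 .$$ The Gaussian free field with boundary $\partial_r$ has $g_x=0$ for $x\in\partial_r$, and $(g_x)_{x\in\mathcal Y}$ has density proportional to $e^{-\beta H_{\mathcal Y}\{(\xi_x)\}}$ with respect to $\prod_{x\in\mathcal Y}d\xi_x$, where $\xi_x=0$ for $x\in\partial_r$. *)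

(* Defs.v *)
From HB Require Import structures.
From mathcomp Require Import all_boot all_order all_algebra.
From mathcomp Require Import all_classical all_reals all_analysis.

Set Implicit Arguments.
Unset Strict Implicit.
Unset Printing Implicit Defensive.

Import Order.TTheory GRing.Theory Num.Theory.
Import numFieldNormedType.Exports.

Local Open Scope classical_set_scope.
Local Open Scope ring_scope.

Section lebesgue_tuple.
Variable R : realType.
Local Notation mR := (measurableTypeR R).

Section cons_measure.
Variables (k : nat) (mu : {sigma_finite_measure set (k.-tuple mR) -> \bar R}).

Definition tuple_cons (p : mR * k.-tuple mR) : k.+1.-tuple mR :=
  [tuple of p.1 :: p.2].

Lemma measurable_tuple_cons : measurable_fun [set: (mR * k.-tuple mR)%type] tuple_cons.
Proof. exact: measurable_cons. Qed.

Definition cons_measure : set (k.+1.-tuple mR) -> \bar R :=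
  pushforward (@lebesgue_measure R \x mu)%E tuple_cons.

Let cons_measure0 : cons_measure set0 = 0%E.
Proof. by rewrite /cons_measure /pushforward preimage_set0 measure0. Qed.

Let mpre A : measurable A -> measurable (tuple_cons @^-1` A).
Proof.
by move=> mA; rewrite -[X in measurable X]setTI; exact: measurable_tuple_cons.
Qed.

Let cons_measure_ge0 A : (0 <= cons_measure A)%E.
Proof. by rewrite /cons_measure /pushforward measure_ge0. Qed.

Let cons_measure_sigma_additive : semi_sigma_additive cons_measure.
Proof.
move=> F mF tF mUF; rewrite /cons_measure /pushforward preimage_bigcup.
apply: measure_semi_sigma_additive.
- by move=> i; exact: mpre.
- apply/trivIsetP => i j _ _ ij; rewrite -preimage_setI.
  by move/trivIsetP : tF => /(_ _ _ _ _ ij) ->//; rewrite preimage_set0.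
- by rewrite -preimage_bigcup; exact: mpre.
Qed.

HB.instance Definition _ := isMeasure.Build _ _ _ cons_measure
  cons_measure0 cons_measure_ge0 cons_measure_sigma_additive.

Let cons_measure_sigma_finite : sigma_finite setT cons_measure.
Proof.
have /sigma_finiteP[F [FT ndF Foo]] := sigma_finiteT (@lebesgue_measure R).
have /sigma_finiteP[G [GT ndG Goo]] := sigma_finiteT mu.
pose uncons (v : k.+1.-tuple mR) : mR * k.-tuple mR :=
  (thead v, [tuple of behead v]).
have unconsK p : uncons (tuple_cons p) = p.
  by case: p => a v; congr pair; exact/val_inj.
have muncons : measurable_fun [set: k.+1.-tuple mR] uncons.
  apply/measurable_fun_pairP; split; first exact: measurable_tnth.
  exact: measurable_behead.
exists (fun i => uncons @^-1` (F i `*` G i)).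
  apply/seteqP; split=> // v _; rewrite -preimage_bigcup /preimage/=.
  have [i _ Fi] : (\bigcup_i F i) (uncons v).1 by rewrite -FT.
  have [j _ Gj] : (\bigcup_i G i) (uncons v).2 by rewrite -GT.
  exists (maxn i j) => //; split.
    by move: Fi; exact/subsetPset/ndF/leq_maxl.
  by move: Gj; exact/subsetPset/ndG/leq_maxr.
move=> i; have [mF Ffin] := Foo i; have [mG Gfin] := Goo i; split.
  rewrite -[X in measurable X]setTI.
  by apply: muncons => //; exact: measurableX.
rewrite /cons_measure /pushforward.
suff -> : tuple_cons @^-1` (uncons @^-1` (F i `*` G i)) = F i `*` G i.
  by rewrite product_measure1E// lte_mul_pinfty// ge0_fin_numE.
by apply/seteqP; split=> p; rewrite /preimage /mkset unconsK.
Qed.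

HB.instance Definition _ :=
  Measure_isSigmaFinite.Build _ _ _ cons_measure cons_measure_sigma_finite.

End cons_measure.

(* The Lebesgue measure on R^k, the k-fold product of the Lebesgue measure on
   the line: see lebesgue_tuple_box. *)
Fixpoint lebesgue_tuple k : {sigma_finite_measure set (k.-tuple mR) -> \bar R} :=
  match k with
  | 0 => \d_ ([tuple] : 0.-tuple mR)
  | k'.+1 => cons_measure (lebesgue_tuple k')
  end.

Lemma lebesgue_tuple_box k (A : 'I_k -> set mR) :
  (forall i, measurable (A i)) ->
  lebesgue_tuple k [set v | forall i, A i (tnth v i)] =
  (\prod_(i < k) lebesgue_measure (A i))%E.
Proof.
elim: k A => [|k IH] A mA.
  rewrite big_ord0 /= diracE mem_set //; by case.
rewrite big_ord_recl -(IH (fun i => A (lift ord0 i))) //.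
rewrite [LHS]/= /cons_measure /pushforward.
have -> : @tuple_cons k @^-1` [set v | forall i, A i (tnth v i)] =
    A ord0 `*` [set v | forall i, A (lift ord0 i) (tnth v i)].
  apply/seteqP; split=> -[a v] /=.
    move=> h; split; first exact: (h ord0).
    move=> i; have := h (lift ord0 i).
    by rewrite tnthS; congr (A _ (tnth _ _)); exact/val_inj.
  move=> [h0 h] i; case: (unliftP ord0 i) => [j|] -> //.
  by rewrite tnthS; have := h j; congr (A _ (tnth _ _)); exact/val_inj.
rewrite product_measure1E //.
have -> : [set v : k.-tuple mR | forall i, A (lift ord0 i) (tnth v i)] =
   \bigcap_(i in [set: 'I_k]) ((@tnth _ mR)^~ i @^-1` A (lift ord0 i)).
  by apply/seteqP; split=> v h i; [move=> _|]; exact: h.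
apply: fin_bigcap_measurable => // i _.
by rewrite -[X in measurable X]setTI; exact: measurable_tnth.
Qed.

End lebesgue_tuple.

Definition correlation d (T : measurableType d) (R : realType)
    (P : probability T R) (X Y : T -> R) : R :=
  fine (covariance P X Y) /
    (Num.sqrt (fine 'V_P[X]) * Num.sqrt (fine 'V_P[Y])).

Definition lattice (d n : nat) := {ffun 'I_d -> 'I_n}.

Definition hamming (d n : nat) (x : lattice d n) : nat :=
  #|[pred i | (x i != 0 :> nat)%N]|.

Definition boundary (d n r : nat) : {set lattice d n} :=
  [set x | r.+1 <= hamming x <= d]%SET%N.

Definition hamiltonian (R : realType) (d n : nat) (Y : {set lattice d n})
    (m : R) (xi : lattice d n -> R) : R :=
  (4 * n%:R ^+ d)^-1 *
    (\sum_(x : lattice d n) \sum_(x' : lattice d n) (xi x - xi x') ^+ 2) +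
  m ^+ 2 / 2 * (\sum_(x in Y) xi x ^+ 2).

(* R^Y is represented by #|Y|-tuples, whose i-th coordinate is the one of index
   enum_val i in Y. *)
Definition zero_extend (R : realType) (T : finType) (Y : {set T})
    (v : #|Y|.-tuple (measurableTypeR R)) (x : T) : R :=
  if x \in Y then nth 0 (v : seq R) (index x (enum Y)) else 0.

Lemma zero_extend_enum_val (R : realType) (T : finType) (Y : {set T})
    (v : #|Y|.-tuple (measurableTypeR R)) (i : 'I_#|Y|) :
  zero_extend v (enum_val i) = tnth v i.
Proof.
rewrite /zero_extend enum_valP (tnth_nth 0) (enum_val_nth (enum_val i)).
by rewrite index_uniq ?enum_uniq // -cardE.
Qed.

(* The normalising constant c is determined by the case A = setT, P being a
   probability. *)
Definition is_gff (R : realType) (d n : nat) (B : {set lattice d n})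
    (beta m : R) (disp : measure_display) (Omega : measurableType disp)
    (P : probability Omega R) (g : lattice d n -> {RV P >-> R}) : Prop :=
  (forall x, x \in B -> forall w, g x w = 0) /\
  exists2 c : R, 0 < c &
    forall A : set (#|~: B|.-tuple (measurableTypeR R)), measurable A ->
      P [set w | A [tuple g (enum_val i) w | i < #|~: B|]] =
      (\int[lebesgue_tuple R #|~: B|]_(v in A)
         (c * expR (- (beta * hamiltonian (~: B) m (zero_extend v))))%:E)%E.

(* Main.v *)
Require Import Defs.
From HB Require Import structures.
From mathcomp Require Import all_boot all_order all_algebra.
From mathcomp Require Import all_classical all_reals all_analysis.
From mathcomp Require Import measurable_realfun ring lra.

Import Order.TTheory GRing.Theory Num.Theory.
Import numFieldNormedType.Exports.

Local Open Scope classical_set_scope.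
Local Open Scope ring_scope.

(* Since sum_{x,x'} (xi_x - xi_x')^2 = 2 N sum xi_x^2 - 2 (sum xi_x)^2 with
   N = n^d, the exponent beta H is a quadratic form in sum xi_x^2 and
   (sum xi_x)^2 only. By completing a square (Hubbard-Stratonovich), exp(-beta H)
   is, up to a constant, the density of the mixture g_x = t Z + s W_x with Z and
   all W_x independent standard normal, s^2 = 1 / (beta (1 + m^2)) and
   t^2 = s^2 / (|B| + N m^2), where B is the boundary. Hence
   Cov(g_x, g_x') = s^2 delta + t^2, which has the announced limit. Conditionally
   on Z the coordinates are independent, so all second moments reduce, by
   Tonelli, to one-dimensional normal moments. *)

(** * Moments of order at most two of the normal law on the line *)

(** The fundamental theorem of calculus on [-n, n] leaves only boundary terms, which vanish in the
    limit; dominated convergence with bound |f| identifies that limit with the full integral. The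
    normal moments follow by exhibiting antiderivatives. *)
Lemma integral_derive_eq0 (R : realType) (F f : R -> R) :
  (forall x, is_derive x (1 : R) F (f x)) -> continuous f ->
  (@lebesgue_measure R).-integrable setT (EFin \o f) ->
  F n%:R @[n --> \oo] --> (0 : R) -> F (- n%:R) @[n --> \oo] --> (0 : R) ->
  (\int[lebesgue_measure]_x (f x)%:E = 0)%E.
Proof.
move=> Ff cf intf Fy FNy.
have cF : continuous F.
  move=> x; apply: differentiable_continuous; apply/derivable1_diffP.
  by have [] := Ff x.
pose D n : set R := `[- n%:R, n%:R]%classic.
pose f_ n := (EFin \o f) \_ (D n).
have ftc n : (\int[lebesgue_measure]_x f_ n x =
    (F n%:R)%:E - (F (- n%:R))%:E)%E.
  (* The interval degenerates to a point for n = 0, where the fundamental theorem does not apply. *)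
  rewrite -integral_mkcond; case: n => [|n].
    by rewrite /D oppr0 set_itv1 integral_set1 subee.
  apply: continuous_FTC2.
  - by rewrite -subr_gt0 opprK addr_gt0 // ltr0n.
  - exact: continuous_subspaceT.
  - split; first by move=> x _; have [] := Ff x.
    + exact/cvg_at_right_filter/cF.
    + exact/cvg_at_left_filter/cF.
  - by move=> x _; rewrite derive1E; have [_ ->] := Ff x.
have mf := measurable_int _ intf.
have [] := @dominated_convergence _ _ _ lebesgue_measure _ measurableT f_
    (EFin \o f) (abse \o (EFin \o f)) => //.
  - move=> n; apply/(measurable_restrictT _ _).1; first exact: measurable_itv.
    exact: measurable_funTS.
  - apply: aeW => x _; apply: cvg_near_cst; near=> n; rewrite /f_ patchE.
    rewrite mem_set// /D /= in_itv /= -ler_norml.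
    near: n; exact: nbhs_infty_ger.
  - exact: integrable_abse.
  - apply: aeW => x n _; rewrite /f_ patchE; case: ifP => // _.
    by rewrite /= normr0 lee_fin.
move=> _ _ cvgf.
have : (\int[lebesgue_measure]_x f_ n x)%E @[n --> \oo] --> (0 : \bar R)%E.
  under eq_fun do rewrite ftc -EFinB.
  apply: cvg_EFin; first exact: nearW.
  by rewrite -[X in _ --> X](subr0 (0 : R)); exact: cvgB.
by move/cvg_unique => /(_ _ _ cvgf) ->.
Unshelve. all: by end_near. Qed.

Section normal_moments.
Context {R : realType} (m s : R) (s_gt0 : 0 < s).
Local Notation mu := (@lebesgue_measure R).

Let s_neq0 : s != 0. Proof. exact: lt0r_neq0. Qed.

Lemma normal_fun_expR x :
  normal_fun m s x = expR (- ((x - m) ^+ 2 / (2 * s ^+ 2))).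
Proof. by rewrite /normal_fun mulr_natl mulNr. Qed.

(** With y = (x - m)^2 / (2 s^2) this is y exp(-y) <= 1, a consequence of 1 + y <= exp y. It
    controls the boundary terms at infinity. *)
Lemma sqr_normal_fun_le x :
  (x - m) ^+ 2 * normal_fun m s x <= 2 * s ^+ 2.
Proof.
rewrite normal_fun_expR expRN -ler_pdivlMr ?invr_gt0 ?expR_gt0 // invrK.
set y := _ / _; have -> : (x - m) ^+ 2 = 2 * s ^+ 2 * y.
  by rewrite /y mulrC divfK // mulf_neq0 ?expf_neq0 ?pnatr_eq0.
rewrite ler_pM2l ?mulr_gt0 ?exprn_gt0 //.
by apply: le_trans (expR_ge1Dx y); rewrite lerDr.
Qed.

Lemma integrable_normal_fun t : t != 0 ->
  mu.-integrable setT (EFin \o normal_fun m t).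
Proof.
move=> t0; rewrite [X in integrable _ _ X](_ : _ =
  fun x => ((normal_peak t)^-1%:E * (normal_pdf m t x)%:E)%E); last first.
  apply/funext => x /=; rewrite -EFinM normal_pdfE // mulKf //.
  by rewrite gt_eqF ?normal_peak_gt0.
by apply: integrableZl => //; exact: integrable_normal_pdf.
Qed.

(** A Gaussian of standard deviation t = sqrt 2 s dominates: with y = (x - m)^2 / (4 s^2) the
    integrand is 4 s^2 y exp(-2y), at most 4 s^2 exp(-y) because y <= exp y. *)
Lemma integrable_centered_sqr_normal :
  mu.-integrable setT (fun x => ((x - m) ^+ 2 * normal_fun m s x)%:E).
Proof.
pose t := Num.sqrt 2 * s.
have t0 : t != 0 by rewrite mulf_neq0 // gt_eqF // sqrtr_gt0.
have /(integrableZl measurableT (4 * s ^+ 2)) := integrable_normal_fun t t0.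
apply: le_integrable => //.
  apply/measurable_EFinP/measurable_funM; last exact: measurable_normal_fun.
  exact/measurable_funX/measurable_funB.
move=> x _ /=; rewrite lee_fin !ger0_norm; last 2 first.
- by rewrite !mulr_ge0 ?sqr_ge0 ?normal_fun_ge0 // ltW.
- by rewrite mulr_ge0 ?sqr_ge0 ?normal_fun_ge0.
rewrite normal_fun_expR /normal_fun.
set y := (x - m) ^+ 2 / (4 * s ^+ 2).
have s20 : s ^+ 2 != 0 by rewrite expf_neq0.
have -> : (x - m) ^+ 2 / (2 * s ^+ 2) = y + y by rewrite /y; field.
have -> : - (x - m) ^+ 2 / (t ^+ 2 *+ 2) = - y.
  by rewrite /t exprMn sqr_sqrtr // /y -mulr_natl; field.
have -> : (x - m) ^+ 2 = 4 * s ^+ 2 * y by rewrite /y; field.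
rewrite -mulrA ler_pM2l ?mulr_gt0 ?exprn_gt0 // opprD expRD mulrA.
rewrite ler_piMl ?expR_ge0 // expRN -ler_pdivlMr ?invr_gt0 ?expR_gt0 // invrK.
by rewrite mul1r; apply: le_trans (expR_ge1Dx y); rewrite lerDr.
Qed.

(** Domination by the two integrable cases already treated, from |u| <= 1 + u^2. *)
Lemma integrable_centered_normal :
  mu.-integrable setT (fun x => ((x - m) * normal_fun m s x)%:E).
Proof.
have := integrableD measurableT (integrable_normal_fun s s_neq0)
  integrable_centered_sqr_normal.
apply: le_integrable => //.
  apply/measurable_EFinP/measurable_funM; last exact: measurable_normal_fun.
  exact: measurable_funB.
move=> x _ /=; rewrite lee_fin normrM [X in _ * X]ger0_norm ?normal_fun_ge0 //.
rewrite -{2}[normal_fun m s x]mul1r -mulrDl normrM.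
rewrite [X in _ <= _ * X]ger0_norm ?normal_fun_ge0 //.
apply: ler_wpM2r; first exact: normal_fun_ge0.
rewrite [X in _ <= X]ger0_norm ?addr_ge0 ?sqr_ge0 // -real_normK ?num_real //.
have := normr_ge0 (x - m); set u := `|_|; nra.
Qed.

Global Instance is_derive_normal_fun x :
  is_derive x (1 : R) (normal_fun m s) (- ((x - m) / s ^+ 2) * normal_fun m s x).
Proof.
have s20 : s ^+ 2 != 0 by rewrite expf_neq0.
have -> : normal_fun m s = expR \o (fun x => (- (2 * s ^+ 2)^-1) * (x - m) ^+ 2).
  apply/funext => y /=; rewrite normal_fun_expR; congr expR.
  by rewrite mulNr mulrC.
apply: is_derive_eq.
by rewrite /GRing.scale /=; field.
Qed.

Lemma continuous_normal_fun : continuous (normal_fun m s).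
Proof.
move=> x; apply: differentiable_continuous; apply/derivable1_diffP.
by have [] := is_derive_normal_fun x.
Qed.

(** By [sqr_normal_fun_le] the first sequence is bounded in absolute value by 2 s^2 / |u n - m|. The
    second is dominated by the first once |u n - m| >= 1. *)
Lemma cvg_centered_normal_fun (u : nat -> R) :
  (`|u n - m| @[n --> \oo] --> +oo) ->
  (u n - m) * normal_fun m s (u n) @[n --> \oo] --> (0 : R) /\
  normal_fun m s (u n) @[n --> \oo] --> (0 : R).
Proof.
move=> uy.
have h : (u n - m) * normal_fun m s (u n) @[n --> \oo] --> (0 : R).
  have cv : (2 * s ^+ 2) * (`|u n - m|)^-1 @[n --> \oo] --> (0 : R).
    rewrite -[X in _ --> X](mulr0 (2 * s ^+ 2)); apply: cvgMr.
    by apply/gtr0_cvgV0 => //; move/cvgryPgt : uy; exact.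
  apply/norm_cvg0P; apply: (squeeze_cvgr _ _ cv); last exact: cvg_cst.
  near=> n; have un : 0 < `|u n - m|.
    by near: n; move/cvgryPgt : uy; exact.
  rewrite normr_ge0 /= normrM [X in _ * X]ger0_norm ?normal_fun_ge0 //.
  rewrite ler_pdivlMr // mulrAC -expr2 real_normK ?num_real //.
  exact: sqr_normal_fun_le.
split=> //.
apply/norm_cvg0P; apply: (squeeze_cvgr _ (cvg_cst (0 : R))); last first.
  exact: (iffRL (norm_cvg0P _) h).
near=> n; have un : 1 <= `|u n - m|.
  by near: n; move/cvgryPge : uy; exact.
by rewrite normr_ge0 /= normrM ler_peMl.
Unshelve. all: by end_near. Qed.

Let cvg_ny : (`|n%:R - m| @[n --> \oo] --> +oo).
Proof.
apply/cvgryPge => A; near=> n.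
have : A + m <= n%:R by near: n; exact: nbhs_infty_ger.
by rewrite -lerBrDr; move/le_trans; apply; exact: ler_norm.
Unshelve. all: by end_near. Qed.

Let cvg_nNy : (`|- n%:R - m| @[n --> \oo] --> +oo).
Proof.
apply/cvgryPge => A; near=> n.
have : A - m <= n%:R by near: n; exact: nbhs_infty_ger.
by rewrite -opprD normrN lerBlDr; move/le_trans; apply; exact: ler_norm.
Unshelve. all: by end_near. Qed.

Lemma integral_centered_normal :
  (\int[mu]_x ((x - m) * normal_fun m s x)%:E = 0)%E.
Proof.
(* Since phi' = -(x - m) / s^2 phi for the Gaussian phi, -s^2 phi is an antiderivative. *)
apply: (@integral_derive_eq0 _ (fun x => - s ^+ 2 * normal_fun m s x)).
- move=> x; apply: is_derive_eq.
  have s20 : s ^+ 2 != 0 by rewrite expf_neq0.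
  by rewrite /GRing.scale /=; field.
- move=> x; apply: cvgM; last exact: continuous_normal_fun.
  by apply: cvgB; [exact: cvg_id|exact: cvg_cst].
- exact: integrable_centered_normal.
- rewrite -[X in _ --> X](mulr0 (- s ^+ 2)); apply: cvgMr.
  exact: (cvg_centered_normal_fun _ cvg_ny).2.
- rewrite -[X in _ --> X](mulr0 (- s ^+ 2)); apply: cvgMr.
  exact: (cvg_centered_normal_fun _ cvg_nNy).2.
Qed.

Lemma integral_centered_sqr_normal :
  (\int[mu]_x (((x - m) ^+ 2 - s ^+ 2) * normal_fun m s x)%:E = 0)%E.
Proof.
(* The antiderivative -s^2 (x - m) phi is the integration by parts behind the variance formula. *)
apply: (@integral_derive_eq0 _
  (fun x => - s ^+ 2 * ((x - m) * normal_fun m s x))).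
- move=> x; apply: is_derive_eq.
  have s20 : s ^+ 2 != 0 by rewrite expf_neq0.
  by rewrite /GRing.scale /=; field.
- move=> x; apply: cvgM; last exact: continuous_normal_fun.
  apply: cvgB; last exact: cvg_cst.
  apply: (cvg_comp (fun x => x - m) (fun y => y ^+ 2)).
    by apply: cvgB; [exact: cvg_id|exact: cvg_cst].
  exact: exprn_continuous.
- rewrite (_ : _ \o _ = (fun x => ((x - m) ^+ 2 * normal_fun m s x)%:E
     - ((s ^+ 2)%:E * (EFin \o normal_fun m s) x))%E); last first.
    by apply/funext => x /=; rewrite mulrBl.
  apply: integrableB => //; first exact: integrable_centered_sqr_normal.
  by apply: integrableZl => //; exact: integrable_normal_fun.
- rewrite -[X in _ --> X](mulr0 (- s ^+ 2)); apply: cvgMr.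
  exact: (cvg_centered_normal_fun _ cvg_ny).1.
- rewrite -[X in _ --> X](mulr0 (- s ^+ 2)); apply: cvgMr.
  exact: (cvg_centered_normal_fun _ cvg_nNy).1.
Qed.

End normal_moments.

(* The polynomials (x - m)^2 - s^2 and x - m are orthogonal to 1 for the normal
   law, so that only the constant term contributes. *)
Lemma integral_quadratic_normal (R : realType) (m s a b c : R) : 0 < s ->
  let f x := (a * ((x - m) ^+ 2 - s ^+ 2) + b * (x - m) + c)
             * normal_pdf m s x in
  (@lebesgue_measure R).-integrable setT (EFin \o f) /\
  (\int[lebesgue_measure]_x (f x)%:E = c%:E)%E.
Proof.
move=> s0 f; have s_neq0 := lt0r_neq0 s0.
have i0 := integrable_normal_pdf m s.
have i1 := integrable_centered_normal m s s0.
have i2 := integrable_centered_sqr_normal m s s0.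
pose g2 x := (((x - m) ^+ 2 - s ^+ 2) * normal_fun m s x)%:E.
pose g1 x := ((x - m) * normal_fun m s x)%:E.
have i2' : (@lebesgue_measure R).-integrable setT g2.
  rewrite (_ : g2 = (fun x => ((x - m) ^+ 2 * normal_fun m s x)%:E
     - ((s ^+ 2)%:E * (EFin \o normal_fun m s) x))%E); last first.
    by apply/funext => x; rewrite /g2 mulrBl.
  by apply: integrableB => //; apply: integrableZl => //;
    exact: integrable_normal_fun.
pose K := normal_peak s.
have fE : EFin \o f = (fun x => (a * K)%:E * g2 x + (b * K)%:E * g1 x +
    c%:E * (normal_pdf m s x)%:E)%E.
  apply/funext => x; rewrite /= -!EFinM -!EFinD; congr EFin.
  by rewrite /f normal_pdfE // /K; ring.
have j2 := integrableZl measurableT (a * K) i2'.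
have j1 := integrableZl measurableT (b * K) i1.
have j0 := integrableZl measurableT c i0.
have j21 := integrableD measurableT j2 j1.
rewrite fE; split; first exact: integrableD.
rewrite -[LHS]/(\int[lebesgue_measure]_x (EFin \o f) x)%E fE.
rewrite integralD //= integralD //= !integralZl //= /g2 /g1.
rewrite integral_centered_sqr_normal // integral_centered_normal //.
by rewrite integral_normal_pdf !mule0 !add0e mule1.
Qed.

(** * Integrals of product functions over R^k *)

Lemma tnth_tuple_consS (R : realType) k (x : R)
    (v : k.-tuple (measurableTypeR R)) i :
  tnth (tuple_cons (x, v)) (lift ord0 i) = tnth v i.
Proof. by rewrite tnthS; congr tnth; exact/val_inj. Qed.

Lemma measurable_prod_tnth (R : realType) k (f : 'I_k -> R -> R) :
  (forall i, measurable_fun setT (f i)) ->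
  measurable_fun setT (fun v : k.-tuple (measurableTypeR R) =>
    \prod_i f i (tnth v i)).
Proof.
move=> mf; apply: measurable_prod => i _.
exact: (measurableT_comp (mf i) (measurable_tnth i)).
Qed.

(** Induction on k: the measure on R^(k+1) is the image under [tuple_cons] of a product measure, so
    Fubini splits off the first coordinate. *)
Lemma integral_lebesgue_tuple_prod (R : realType) k (f : 'I_k -> R -> R) :
  (forall i, (@lebesgue_measure R).-integrable setT (EFin \o f i)) ->
  (lebesgue_tuple R k).-integrable setT
    (fun v => (\prod_i f i (tnth v i))%:E) /\
  (\int[lebesgue_tuple R k]_v (\prod_i f i (tnth v i))%:E =
   \prod_i \int[lebesgue_measure]_x (f i x)%:E)%E.
Proof.
move=> intf.
have mf k' (f' : 'I_k' -> R -> R) :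
    (forall i, (@lebesgue_measure R).-integrable setT (EFin \o f' i)) ->
    measurable_fun setT (fun v : k'.-tuple (measurableTypeR R) =>
      (\prod_i f' i (tnth v i))%:E).
  move=> intf'; apply/measurable_EFinP; apply: measurable_prod_tnth => i.
  have h := measurable_int _ (intf' i); apply/measurable_EFinP. exact: h.
elim: k f intf => [|k IH] f intf.
  have E (v : 0.-tuple (measurableTypeR R)) :
      (\prod_(i < 0) f i (tnth v i))%:E = 1%:E by rewrite big_ord0.
  split.
    under eq_fun do rewrite E.
    by apply: finite_measure_integrable_cst.
  under eq_integral do rewrite E.
  by rewrite integral_cst //= diracT mule1 big_ord0.
have [IHi IHe] := IH (fun i => f (lift ord0 i)) (fun i => intf _).
have tE x v : (\prod_i f i (tnth (tuple_cons (x, v)) i))%:E =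
    ((f ord0 x)%:E * (\prod_i f (lift ord0 i) (tnth v i))%:E)%E.
  rewrite big_ord_recl EFinM; congr ((f _ _)%:E * EFin _)%E.
  by apply: eq_bigr => i _; rewrite tnth_tuple_consS.
have mtc := @measurable_tuple_cons R k.
have mft : measurable_fun setT
    (fun p => (\prod_i f i (tnth (@tuple_cons R k p) i))%:E).
  by apply: (measurableT_comp (mf _ _ intf)).
(* Tonelli for the absolute value: the iterated integral factors into two finite ones. *)
have intp : (@lebesgue_measure R \x lebesgue_tuple R k)%E.-integrable setT
    (fun p => (\prod_i f i (tnth (@tuple_cons R k p) i))%:E).
  apply/integrable12ltyP => //.
  under eq_integral => x _.
    under eq_integral do rewrite tE abseM.
    rewrite ge0_integralZl //; last first.
      by apply: measurableT_comp => //; exact: (measurable_int _ IHi).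
    over.
  rewrite ge0_integralZr //.
  - rewrite lte_mul_pinfty //.
    + exact: integral_ge0.
    + rewrite ge0_fin_numE; last exact: integral_ge0.
      by have /integrableP[] := intf ord0.
    + by have /integrableP[] := IHi.
  - apply: measurableT_comp => //.
    exact: (measurable_int _ (intf ord0)).
  - exact: integral_ge0.
split.
  apply: integrable_pushforward => //; exact: mf.
rewrite [LHS]integral_pushforward //; last exact: mf.
rewrite preimage_setT -integral12_prod_meas1 // big_ord_recl -IHe.
rewrite /fubini_F /=.
under eq_integral => x _.
  under eq_integral do rewrite tE.
  rewrite integralZl //.
  over.
rewrite -(fineK (integrable_fin_num measurableT IHi)) integralZr //.
exact: (intf ord0).
Qed.

(** * Integration against a density, and linear combinations of known integrals *)

(** The law of X is absolutely continuous with respect to mu, so integrals against it are integrals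
    against its Radon-Nikodym derivative, which agrees almost everywhere with h. *)
Lemma ge0_integral_density {d d'} {T : measurableType d} {T' : measurableType d'}
    {R : realType} (P : probability T R) (X : {mfun T >-> T'})
    (mu : {sigma_finite_measure set T' -> \bar R}) (h : T' -> \bar R)
    (f : T' -> \bar R) :
  measurable_fun setT h ->
  (forall A, measurable A -> P (X @^-1` A) = \int[mu]_(x in A) h x)%E ->
  measurable_fun setT f -> (forall x, 0 <= f x)%E ->
  (\int[P]_w f (X w) = \int[mu]_x (f x * h x))%E.
Proof.
move=> mh Ph mf f0.
pose nu : probability T' R := distribution P X.
have numu : nu `<< mu.
  apply/null_content_dominatesP => A mA muA.
  rewrite /nu /= /distribution /pushforward Ph //.
  by apply: null_set_integral => //; exact: measurable_funTS.
have fint := Radon_Nikodym_SigmaFinite.f_integrable numu.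
have -> : (\int[P]_w f (X w) = \int[nu]_x f x)%E.
  by rewrite ge0_integral_pushforward //= preimage_setT.
rewrite -(Radon_Nikodym_SigmaFinite.change_of_variables numu) //.
apply: ae_eq_integral => //.
- by apply: emeasurable_funM => //; exact: (measurable_int mu).
- exact: emeasurable_funM.
(* The derivative and h have the same integral over every measurable set, namely the law of X on
   that set. *)
apply: ae_eqe_mul2l; apply: integral_ae_eq => // A _ mA.
by rewrite -Radon_Nikodym_SigmaFinite.f_integral // -Ph.
Qed.

Section integrates.
Context {d} {T : measurableType d} {R : realType}
  (mu : {measure set T -> \bar R}).
Implicit Types (f g : T -> R) (a b : R).

(** Integrability and value are kept together so that linear combinations propagate both at once. *)
Definition integrates f a :=
  mu.-integrable setT (EFin \o f) /\ (\int[mu]_x (f x)%:E = a%:E)%E.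

Lemma integratesD f g a b : integrates f a -> integrates g b ->
  integrates (fun x => f x + g x) (a + b).
Proof.
move=> [fi fa] [gi gb]; split; first exact: (integrableD measurableT fi gi).
by under eq_integral do rewrite EFinD; rewrite integralD // fa gb.
Qed.

Lemma integratesZ r f a : integrates f a ->
  integrates (fun x => r * f x) (r * a).
Proof.
move=> [fi fa]; split; first exact: (integrableZl measurableT r fi).
by under eq_integral do rewrite EFinM; rewrite integralZl // fa.
Qed.

End integrates.

(** Lets a single factor be read as a monomial whose exponents are a Kronecker delta. *)
Lemma prod_expr_delta (R : comNzRingType) (I : finType) (F : I -> R) i :
  \prod_l F l ^+ (l == i) = F i.
Proof.
rewrite (bigD1 i) //= eqxx expr1 big1 ?mulr1 // => l /negbTE ->.
by rewrite expr0.
Qed.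

(** * Second moments of independent normal coordinates *)

Section gaussian_product.
Context {R : realType} (k : nat) (m s : R) (s_gt0 : 0 < s).
Local Notation mu := (lebesgue_tuple R k).
Implicit Types v : k.-tuple (measurableTypeR R).

Definition normal_product v : R := \prod_l normal_pdf m s (tnth v l).

(** The list holds the centred moments of order 0, 1 and 2; independence turns the integral into
    their product. *)
Lemma integrates_centered_monomial (e : 'I_k -> nat) :
  (forall l, e l <= 2)%N ->
  integrates mu
    (fun v => (\prod_l (tnth v l - m) ^+ e l) * normal_product v)
    (\prod_l nth 0 [:: 1; 0; s ^+ 2] (e l)).
Proof.
move=> e2.
pose f l x := (x - m) ^+ e l * normal_pdf m s x.
have h l : (@lebesgue_measure R).-integrable setT (EFin \o f l) /\
    (\int[lebesgue_measure]_x (f l x)%:E = (nth 0 [:: 1; 0; s ^+ 2] (e l))%:E)%E.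
  rewrite /f; move: (e l) (e2 l) => [|[|[|//]]] _ /=.
  (* The powers 1, x - m and (x - m)^2 = ((x - m)^2 - s^2) + s^2 in the orthogonal basis. *)
  - have := integral_quadratic_normal R m s 0 0 1 s_gt0.
    by under eq_fun do rewrite !mul0r !add0r.
  - have := integral_quadratic_normal R m s 0 1 0 s_gt0.
    by under eq_fun do rewrite mul0r add0r mul1r addr0.
  - have := integral_quadratic_normal R m s 1 0 (s ^+ 2) s_gt0.
    by under eq_fun do rewrite mul0r addr0 mul1r subrK.
have [fi fe] := integral_lebesgue_tuple_prod R k f (fun l => (h l).1).
split.
  by move: fi; congr (integrable _ _ _); apply/funext => v /=;
    rewrite /f big_split.
under eq_integral do rewrite -big_split /=.
rewrite fe -prodEFin; apply: eq_bigr => l _.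
exact: (h l).2.
Qed.

(** The affine form is recentred as a (v_i - m) + b (v_j - m) + C, where C is its value at the mean;
    expanding the square leaves six centred monomials. *)
Lemma integrates_quadratic_normal_product i j a b c :
  integrates mu
    (fun v => (a * tnth v i + b * tnth v j + c) ^+ 2 * normal_product v)
    ((a ^+ 2 + b ^+ 2 + 2 * a * b * (i == j)%:R) * s ^+ 2
     + ((a + b) * m + c) ^+ 2).
Proof.
have mono2 i' j' : integrates mu
    (fun v => (tnth v i' - m) * (tnth v j' - m) * normal_product v)
    ((i' == j')%:R * s ^+ 2).
  have := integrates_centered_monomial (fun l => (l == i') + (l == j'))%N.
  rewrite [X in integrates _ X](_ : _ =
    (fun v => (tnth v i' - m) * (tnth v j' - m) * normal_product v)); last first.
    apply/funext => v; under eq_bigr do rewrite exprD.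
    by rewrite big_split /= !prod_expr_delta.
  rewrite [X in integrates _ _ X](_ : _ = (i' == j')%:R * s ^+ 2); last first.
    (* For distinct indices some coordinate has exponent 1 and contributes a factor 0; for equal
       ones the exponent is 2. *)
    rewrite (bigD1 i') //= eqxx; case: eqVneq => [<-|]; rewrite ?mul0r //.
    by rewrite big1 ?mulr1 ?mul1r // => l /negbTE ->.
  by apply=> l; do 2 case: eqP.
have mono1 i' : integrates mu
    (fun v => (tnth v i' - m) * normal_product v) 0.
  have := integrates_centered_monomial (fun l => (l == i') : nat).
  rewrite [X in integrates _ X](_ : _ =
    (fun v => (tnth v i' - m) * normal_product v)); last first.
    by apply/funext => v; rewrite prod_expr_delta.
  rewrite [X in integrates _ _ X](_ : _ = 0); last first.
    by rewrite (bigD1 i') //= eqxx mul0r.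
  by apply=> l; case: eqP.
have mono0 : integrates mu normal_product 1.
  have := integrates_centered_monomial (fun=> 0%N).
  rewrite [X in integrates _ X](_ : _ = normal_product); last first.
    by apply/funext => v; rewrite big1 ?mul1r.
  by rewrite big1 //; apply.
pose C := (a + b) * m + c.
have := integratesD _ _ _ _ _ (integratesD _ _ _ _ _
  (integratesD _ _ _ _ _ (integratesZ _ (a ^+ 2) _ _ (mono2 i i))
                         (integratesZ _ (b ^+ 2) _ _ (mono2 j j)))
  (integratesD _ _ _ _ _ (integratesZ _ (2 * a * b) _ _ (mono2 i j))
                         (integratesZ _ (2 * a * C) _ _ (mono1 i))))
  (integratesD _ _ _ _ _ (integratesZ _ (2 * b * C) _ _ (mono1 j))
                         (integratesZ _ (C ^+ 2) _ _ mono0)).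
congr (integrates _ _ _).
  by apply/funext => v; rewrite /C; ring.
by rewrite /C !eqxx /=; ring.
Qed.

End gaussian_product.

(** * The Gaussian mixture t Z + s W_l: density and second moments *)

Section gaussian_mixture.
Context {R : realType} (k : nat) (t s : R) (s_gt0 : 0 < s).
Local Notation mu := (lebesgue_tuple R k).
Implicit Types v : k.-tuple (measurableTypeR R).

(* Minus the logarithm of the density of (t Z + s W_l)_l, up to a constant. *)
Definition mixture_energy v : R :=
  (\sum_l tnth v l ^+ 2) / (2 * s ^+ 2) -
  t ^+ 2 / (2 * s ^+ 2 * (s ^+ 2 + k%:R * t ^+ 2)) * (\sum_l tnth v l) ^+ 2.

Let s_neq0 : s != 0. Proof. exact: lt0r_neq0. Qed.

Let var_gt0 : 0 < s ^+ 2 + k%:R * t ^+ 2.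
Proof.
by rewrite ltr_wpDr ?exprn_gt0 // mulr_ge0 ?ler0n ?sqr_ge0.
Qed.

Lemma normal_productE m v :
  normal_product k m s v = normal_peak s ^+ k *
    expR (- (\sum_l (tnth v l - m) ^+ 2 / (2 * s ^+ 2))).
Proof.
rewrite /normal_product -sumrN expR_sum.
under eq_bigr do rewrite normal_pdfE // normal_fun_expR.
by rewrite big_split /= prodr_const card_ord.
Qed.

Lemma measurable_mixture :
  measurable_fun setT
    (fun p : k.-tuple (measurableTypeR R) * measurableTypeR R =>
      normal_pdf 0 1 p.2 * normal_product k (t * p.2) s p.1).
Proof.
apply: measurable_funM.
  exact: (measurableT_comp (measurable_normal_pdf _ _) measurable_snd).
rewrite (_ : (fun _ => _) = fun p => normal_peak s ^+ k *
    expR (- (\sum_l (tnth p.1 l - t * p.2) ^+ 2 / (2 * s ^+ 2)))); last first.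
  by apply/funext => p; rewrite normal_productE.
apply: measurable_funM => //; apply: measurableT_comp => //.
apply: measurableT_comp => //; apply: measurable_sum => l.
apply: measurable_funM => //; apply: measurable_funX; apply: measurable_funB.
  exact: (measurableT_comp (measurable_tnth l) measurable_fst).
by apply: measurable_funM => //; exact: measurable_snd.
Qed.

(** Completing the square in z: for fixed v the joint density is its marginal at v times a normal
    density in z, the conditional law of Z, which integrates to 1. *)
Lemma mixture_density : exists2 C : R, 0 < C & forall v,
  (\int[lebesgue_measure]_z
     (normal_pdf 0 1 z * normal_product k (t * z) s v)%:E =
   (C * expR (- mixture_energy v))%:E)%E.
Proof.
(* The conditional standard deviation of Z given v; [M] below is the conditional mean. *)
pose q := s / Num.sqrt (s ^+ 2 + k%:R * t ^+ 2).
have q0 : 0 < q by rewrite divr_gt0 // sqrtr_gt0.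
have q2 : q ^+ 2 = s ^+ 2 / (s ^+ 2 + k%:R * t ^+ 2).
  by rewrite /q expr_div_n sqr_sqrtr // ltW.
have q_neq0 := lt0r_neq0 q0.
pose C := normal_peak 1 * normal_peak s ^+ k / @normal_peak R q.
have C0 : 0 < C.
  rewrite divr_gt0 ?normal_peak_gt0 // mulr_gt0 ?exprn_gt0 ?normal_peak_gt0 ?oner_neq0 //.
exists C => // v.
pose S := \sum_l tnth v l.
pose M := t * S / (s ^+ 2 + k%:R * t ^+ 2).
have E z : normal_pdf 0 1 z * normal_product k (t * z) s v =
    C * expR (- mixture_energy v) * normal_pdf M q z.
  rewrite normal_productE normal_pdfE ?oner_neq0 // (normal_pdfE M) //.
  rewrite !normal_fun_expR /C.
  transitivity (normal_peak 1 * normal_peak s ^+ k *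
    (expR (- mixture_energy v) * expR (- ((z - M) ^+ 2 / (2 * q ^+ 2))))); last first.
    by field; rewrite gt_eqF // normal_peak_gt0.
  rewrite mulrACA -!expRD; congr (_ * expR _).
  rewrite -mulr_suml.
  under eq_bigr do rewrite sqrrB.
  rewrite big_split sumrB /= sumr_const card_ord sumrMnl -mulr_suml -/S.
  rewrite /mixture_energy -/S q2 /M.
  set V := \sum_l tnth v l ^+ 2.
  rewrite -[_ *+ k]mulr_natr -[_ *+ 2]mulr_natr.
  by field; rewrite s_neq0 gt_eqF.
under eq_integral do rewrite E EFinM.
rewrite integralZl //; last exact: integrable_normal_pdf.
by rewrite integral_normal_pdf mule1.
Qed.

Lemma measurable_mixture_energy : measurable_fun setT mixture_energy.
Proof.
apply: measurable_funB; apply: measurable_funM => //.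
  by apply: measurable_sum => l; apply: measurable_funX; exact: measurable_tnth.
apply: measurable_funX; apply: measurable_sum => l; exact: measurable_tnth.
Qed.

(** Squares of affine forms are nonnegative, so Tonelli allows integrating over v first, with z
    fixed and the coordinates independent of mean t z. One C serves all coefficients; a = b = 0, c =
    1 gives the total mass. *)
Lemma mixture_second_moments : exists2 C : R, 0 < C & forall i j a b c,
  (\int[mu]_v ((a * tnth v i + b * tnth v j + c) ^+ 2 *
     (C * expR (- mixture_energy v)))%:E =
   ((a ^+ 2 + b ^+ 2 + 2 * a * b * (i == j)%:R) * s ^+ 2
     + (a + b) ^+ 2 * t ^+ 2 + c ^+ 2)%:E)%E.
Proof.
have [C C0 mix] := mixture_density; exists C => // i j a b c.
pose F v := (a * tnth v i + b * tnth v j + c) ^+ 2.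
have mF : measurable_fun setT F.
  apply: measurable_funX; apply: measurable_funD => //.
  apply: measurable_funD; apply: measurable_funM => //; exact: measurable_tnth.
have W0 v z : 0 <= normal_pdf 0 1 z * normal_product k (t * z) s v.
  by rewrite mulr_ge0 ?normal_pdf_ge0 // prodr_ge0 // => l _; exact: normal_pdf_ge0.
pose G (p : k.-tuple (measurableTypeR R) * measurableTypeR R) :=
  (F p.1 * (normal_pdf 0 1 p.2 * normal_product k (t * p.2) s p.1))%:E.
have mG : measurable_fun setT G.
  apply/measurable_EFinP; apply: measurable_funM; last exact: measurable_mixture.
  exact: (measurableT_comp mF measurable_fst).
have G0 p : (0 <= G p)%E by rewrite lee_fin mulr_ge0 ?sqr_ge0.
transitivity (\int[mu]_v \int[lebesgue_measure]_z G (v, z))%E.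
  apply: eq_integral => v _; rewrite EFinM -mix /G /=.
  under [RHS]eq_integral do rewrite EFinM.
  rewrite ge0_integralZl //.
  - apply/measurable_EFinP.
    exact: (measurableT_comp measurable_mixture (measurable_pair1 v)).
  - by move=> z _; rewrite lee_fin.
  - by rewrite lee_fin sqr_ge0.
rewrite (fubini_tonelli G) //.
pose A := (a ^+ 2 + b ^+ 2 + 2 * a * b * (i == j)%:R) * s ^+ 2.
(* The inner integral A + ((a + b) t z + c)^2, rewritten in terms of z^2 - 1, z and 1, of which only
   the last contributes. *)
transitivity (\int[lebesgue_measure]_z
  (((a + b) ^+ 2 * t ^+ 2 * ((z - 0) ^+ 2 - 1 ^+ 2)
    + 2 * (a + b) * t * c * (z - 0)
    + (A + (a + b) ^+ 2 * t ^+ 2 + c ^+ 2)) * normal_pdf 0 1 z)%:E)%E.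
  apply: eq_integral => z _; rewrite /G /=.
  have [ii ie] := integrates_quadratic_normal_product k (t * z) s s_gt0 i j a b c.
  under eq_integral do rewrite mulrCA EFinM.
  rewrite integralZl // ie -EFinM; congr EFin.
  by rewrite mulrC; congr (_ * _); rewrite /A; ring.
by have [] := integral_quadratic_normal R 0 1 ((a + b) ^+ 2 * t ^+ 2)
  (2 * (a + b) * t * c) (A + (a + b) ^+ 2 * t ^+ 2 + c ^+ 2) ltr01.
Qed.

End gaussian_mixture.

(** * From second moments to covariances *)

(** X = ((X + 1)^2 - (X - 1)^2) / 4 and XY = ((X + Y)^2 - (X - Y)^2) / 4 recover the means, both 0,
    and the mixed moment w. Finiteness of the integrals of squares supplies integrability. *)
Lemma covariance_polarization {d} {T : measurableType d} {R : realType}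
    (P : probability T R) (X Y : {RV P >-> R}) (vX vY w : R) :
  (forall a b c, \int[P]_x ((a * X x + b * Y x + c) ^+ 2)%:E =
     (a ^+ 2 * vX + b ^+ 2 * vY + 2 * a * b * w + c ^+ 2)%:E)%E ->
  covariance P X Y = w%:E.
Proof.
move=> h.
have H a b c : integrates P (fun x => (a * X x + b * Y x + c) ^+ 2)
     (a ^+ 2 * vX + b ^+ 2 * vY + 2 * a * b * w + c ^+ 2).
  split=> //; apply/integrableP; split.
    apply/measurable_EFinP; apply: measurable_funX; apply: measurable_funD => //.
    by apply: measurable_funD; apply: measurable_funM.
  under eq_integral do rewrite /= ger0_norm ?sqr_ge0 //.
  by rewrite h ltry.
have polar a b c a' b' c' := integratesD _ _ _ _ _
  (integratesZ _ (1 / 4) _ _ (H a b c)) (integratesZ _ (- (1 / 4)) _ _ (H a' b' c')).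
have IX : integrates P X 0.
  have := polar 1 0 1 1 0 (-1); congr (integrates _ _ _); last by field.
  by apply/funext => x; field.
have IY : integrates P Y 0.
  have := polar 0 1 1 0 1 (-1); congr (integrates _ _ _); last by field.
  by apply/funext => x; field.
have IXY : integrates P (X * Y) w.
  have := polar 1 1 0 1 (-1) 0; congr (integrates _ _ _); last by field.
  by apply/funext => x; rewrite -[RHS]/(X x * Y x); field.
have L1 (f : T -> R) r : integrates P f r -> f \in Lfun P 1.
  by move=> [fi _]; exact/Lfun1_integrable.
rewrite covarianceE; [|exact: L1 IX|exact: L1 IY|exact: L1 IXY].
by rewrite unlock IX.2 IY.2 IXY.2 mule0 sube0.
Qed.

(** * The Hamiltonian as a quadratic form, and the exact covariance at m > 0 *)

Lemma sum_sqr_diff (R : comNzRingType) (T : finType) (xi : T -> R) :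
  \sum_x \sum_y (xi x - xi y) ^+ 2 =
  2 * #|T|%:R * (\sum_x xi x ^+ 2) - 2 * (\sum_x xi x) ^+ 2.
Proof.
under eq_bigr => x _.
  under eq_bigr do rewrite sqrrB.
  rewrite big_split sumrB /= sumr_const sumrMnl -mulr_sumr.
  over.
rewrite big_split sumrB /= sumr_const !sumrMnl -mulr_suml.
set V := \sum_i xi i ^+ 2; set S := \sum_i xi i.
rewrite -(mulr_natl V) -(mulr_natl (S * S)).
by move: #|T|%:R => c; ring.
Qed.

(** Sites outside Y carry the value 0, so all sums reduce to Y. As the lattice has n^d points, the
    interaction contributes 1/2 to the coefficient of the squares, next to m^2 / 2 from the mass. *)
Lemma hamiltonian_zero_extend (R : realType) d n (Y : {set lattice d n}) (m : R)
    (v : #|Y|.-tuple (measurableTypeR R)) :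
  (0 < n)%N ->
  hamiltonian Y m (zero_extend v) =
  (1 + m ^+ 2) / 2 * (\sum_i tnth v i ^+ 2) -
  (2 * n%:R ^+ d)^-1 * (\sum_i tnth v i) ^+ 2.
Proof.
move=> n0.
have sum1 : \sum_x zero_extend v x = \sum_i tnth v i.
  rewrite (bigID (mem Y)) /= [X in _ + X]big1 ?addr0; last first.
    by move=> x /negbTE xY; rewrite /zero_extend xY.
  by rewrite big_enum_val; apply: eq_bigr => i _; rewrite zero_extend_enum_val.
have sum2Y : \sum_(x in Y) zero_extend v x ^+ 2 = \sum_i tnth v i ^+ 2.
  by rewrite big_enum_val; apply: eq_bigr => i _; rewrite zero_extend_enum_val.
have sum2 : \sum_x zero_extend v x ^+ 2 = \sum_i tnth v i ^+ 2.
  rewrite (bigID (mem Y)) /= sum2Y [X in _ + X]big1 ?addr0 //.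
  by move=> x /negbTE xY; rewrite /zero_extend xY expr0n.
rewrite /hamiltonian sum_sqr_diff sum1 sum2 sum2Y card_ffun !card_ord natrX.
by field; rewrite expf_neq0 // pnatr_eq0 -lt0n.
Qed.

(* s^2 delta + t^2 for the mixture above, with N sites, b of them on the
   boundary. *)
Definition gff_covariance {R : realType} (beta N b delta m : R) : R :=
  (beta * (1 + m ^+ 2))^-1 * (delta + (b + N * m ^+ 2)^-1).

Lemma gff_covariance_ge0 (R : realType) (beta N b delta m : R) :
  0 <= beta -> 0 <= N -> 0 <= b -> 0 <= delta ->
  0 <= gff_covariance beta N b delta m.
Proof.
move=> beta0 N0 b0 delta0; apply: mulr_ge0.
  by rewrite invr_ge0 mulr_ge0 // addr_ge0 // sqr_ge0.
by rewrite addr_ge0 // invr_ge0 addr_ge0 // mulr_ge0 // sqr_ge0.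
Qed.

(** The field outside B has the law of the mixture: the exponents agree for suitable s and t, and
    the normalising constants agree because both densities have mass 1. *)
Lemma covariance_gff (R : realType) d n (B : {set lattice d n}) (beta m : R)
    (disp : measure_display) (Omega : measurableType disp)
    (P : probability Omega R) (g : lattice d n -> {RV P >-> R}) x x' :
  (0 < n)%N -> 0 < beta -> (0 < #|B|)%N ->
  is_gff B beta m g -> x \notin B -> x' \notin B ->
  covariance P (g x) (g x') =
    (gff_covariance beta (n%:R ^+ d) #|B|%:R (x == x')%:R m)%:E.
Proof.
move=> n0 beta0 B0 [_ [c c0 gE]] xB x'B.
pose k := #|~: B|; pose N : R := n%:R ^+ d; pose b : R := #|B|%:R.
have b0 : 0 < b by rewrite ltr0n.
have Nkb : N = b + k%:R.
  by rewrite -natrD cardsC card_ffun !card_ord natrX.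
have N0 : 0 < N by rewrite Nkb ltr_wpDr.
have m1 : 0 < 1 + m ^+ 2 by rewrite ltr_wpDr ?sqr_ge0.
have bm : 0 < b + N * m ^+ 2 by rewrite ltr_wpDr // mulr_ge0 ?sqr_ge0 // ltW.
pose s := Num.sqrt (beta * (1 + m ^+ 2))^-1.
have s0 : 0 < s by rewrite sqrtr_gt0 invr_gt0 mulr_gt0.
have s2 : s ^+ 2 = (beta * (1 + m ^+ 2))^-1.
  by rewrite sqr_sqrtr // invr_ge0 mulr_ge0 // ltW.
(* Since N = b + k, this gives s^2 + k t^2 = s^2 N (1 + m^2) / (b + N m^2), so the squared sum in
   the energy gets the coefficient beta / (2 N) of the Hamiltonian. *)
pose t := s / Num.sqrt (b + N * m ^+ 2).
have t2 : t ^+ 2 = (beta * (1 + m ^+ 2))^-1 / (b + N * m ^+ 2).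
  by rewrite expr_div_n s2 sqr_sqrtr // ltW.
have energyE (v : k.-tuple (measurableTypeR R)) :
    beta * hamiltonian (~: B) m (zero_extend v) = mixture_energy k t s v.
  rewrite hamiltonian_zero_extend // -/N /mixture_energy s2 t2.
  set V := \sum_l _ ^+ 2; set S := \sum_l _.
  have -> : k%:R = N - b :> R by rewrite Nkb addrAC subrr add0r.
  by field; rewrite !gt_eqF //; nra.
have [C C0 mom] := mixture_second_moments k t s s0.
have kx : x \in ~: B by rewrite inE.
have kx' : x' \in ~: B by rewrite inE.
pose i := enum_rank_in kx x; pose i' := enum_rank_in kx x'.
have xi : enum_val i = x by exact: enum_rankK_in.
have xi' : enum_val i' = x' by exact: enum_rankK_in.
have ii' : (i == i') = (x == x') by rewrite -(inj_eq enum_val_inj) xi xi'.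
pose G w : k.-tuple (measurableTypeR R) := [tuple g (enum_val l) w | l < k].
have mG : measurable_fun setT G.
  apply/measurable_fun_tnthP => l.
  rewrite (_ : _ \o _ = (g (enum_val l) : Omega -> R)).
    have mg : measurable_fun setT (g (enum_val l)) by exact: measurable_funPT.
    exact: mg.
  by apply/funext => w; rewrite /= tnth_mktuple.
pose GX : {mfun Omega >-> k.-tuple (measurableTypeR R)} :=
  HB.pack G (isMeasurableFun.Build _ _ _ _ G mG).
pose h (v : k.-tuple (measurableTypeR R)) :=
  (c * expR (- (beta * hamiltonian (~: B) m (zero_extend v))))%:E.
have hE v : h v = (c * expR (- mixture_energy k t s v))%:E.
  by rewrite /h energyE.
have mh : measurable_fun setT h.
  rewrite (funext hE); apply/measurable_EFinP; apply: measurable_funM => //.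
  apply: measurableT_comp => //; apply: measurableT_comp => //.
  exact: measurable_mixture_energy.
have cC : c = C.
  pose I := (\int[lebesgue_tuple R k]_v (expR (- mixture_energy k t s v))%:E)%E.
  have scal a : 0 < a ->
      (\int[lebesgue_tuple R k]_v (a * expR (- mixture_energy k t s v))%:E =
       a%:E * I)%E.
    move=> a0; under eq_integral do rewrite EFinM.
    rewrite ge0_integralZl ?lee_fin ?ltW //.
    apply/measurable_EFinP; do 2 apply: measurableT_comp => //.
    exact: measurable_mixture_energy.
  have cI : (c%:E * I = 1)%E.
    rewrite -scal // -(probability_setT P); transitivity (P [set w | setT (G w)]).
      by rewrite gE //; apply: eq_integral => v _; rewrite -hE.
    by congr (P _); exact/seteqP.
  (* The second moment formula for the constant form 1 gives the mass of the mixture density. *)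
  have CI : (C%:E * I = 1)%E.
    rewrite -scal //; transitivity ((0 ^+ 2 + 0 ^+ 2 + 2 * 0 * 0 * (i == i)%:R) *
      s ^+ 2 + (0 + 0) ^+ 2 * t ^+ 2 + 1 ^+ 2)%:E; last by congr EFin; ring.
    rewrite -mom; apply: eq_integral => v _.
    by rewrite !mul0r !add0r expr1n mul1r.
  have /fineK Ifin : I \is a fin_num.
    move: cI; case: (I) => // [|].
      by rewrite gt0_muley ?lte_fin.
    by rewrite gt0_muleNy ?lte_fin.
  move: cI CI; rewrite -Ifin -!EFinM => -[cI] [CI].
  have I0 : fine I != 0.
    by apply/eqP => I0; move/eqP: cI; rewrite I0 mulr0 eq_sym oner_eq0.
  by apply: (mulIf I0); rewrite cI CI.
(* The common variance of the coordinates of t Z + s W. *)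
pose vr := s ^+ 2 + t ^+ 2.
rewrite (covariance_polarization P (g x) (g x') vr vr
  ((x == x')%:R * s ^+ 2 + t ^+ 2)); last first.
  move=> a e f.
  have mF : measurable_fun setT (fun v : k.-tuple (measurableTypeR R) =>
      ((a * tnth v i + e * tnth v i' + f) ^+ 2)%:E).
    apply/measurable_EFinP; apply: measurable_funX; apply: measurable_funD => //.
    by apply: measurable_funD; apply: measurable_funM => //; exact: measurable_tnth.
  transitivity (\int[P]_w ((a * tnth (GX w) i + e * tnth (GX w) i' + f) ^+ 2)%:E)%E.
    by apply: eq_integral => w _; rewrite /= /G !tnth_mktuple xi xi'.
  rewrite (ge0_integral_density P GX (lebesgue_tuple R k) h _ mh gE mF); last first.
    by move=> v; rewrite lee_fin sqr_ge0.
  have momE := mom i i' a e f; rewrite ii' in momE.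
  rewrite [RHS](_ : _ = ((a ^+ 2 + e ^+ 2 + 2 * a * e * (x == x')%:R) * s ^+ 2
    + (a + e) ^+ 2 * t ^+ 2 + f ^+ 2)%:E); last by rewrite /vr; congr EFin; ring.
  by rewrite -momE; apply: eq_integral => v _; rewrite hE cC -EFinM.
rewrite /gff_covariance -/N -/b t2 s2; congr EFin.
by rewrite [X in X + _]mulrC -mulrDr.
Qed.

(** * The massless limit *)

(** Continuity at m = 0, where the denominators are beta and b, both positive. *)
Lemma cvg_gff_covariance (R : realType) (beta N b delta : R) :
  0 < beta -> 0 < b ->
  gff_covariance beta N b delta m @[m --> 0^'+] --> beta^-1 * (delta + b^-1).
Proof.
move=> beta0 b0; apply: cvg_at_right_filter.
have -> : beta^-1 * (delta + b^-1) = gff_covariance beta N b delta 0.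
  by rewrite /gff_covariance expr0n /= mulr0 !addr0 mulr1.
have sq : (fun m : R => m ^+ 2) @ 0 --> (0 : R) ^+ 2 by exact: exprn_continuous.
apply: cvgM.
  apply: cvgV; first by rewrite expr0n /= addr0 mulr1 gt_eqF.
  by apply: cvgMr; apply: cvgD sq; exact: cvg_cst.
apply: cvgD; first exact: cvg_cst.
apply: cvgV; first by rewrite expr0n /= mulr0 addr0 gt_eqF.
by apply: cvgD; [exact: cvg_cst|exact: cvgMr].
Qed.

(** The site with all coordinates n - 1, nonzero as n > 1, is at Hamming distance d > r. *)
Lemma boundary_gt0 d n r : (1 < n)%N -> (r < d)%N -> (0 < #|boundary d n r|)%N.
Proof.
case: n => [|[|n]] // _ rd; apply/card_gt0P.
exists [ffun=> ord_max]; rewrite inE.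
rewrite (_ : hamming _ = d) ?rd ?leqnn //.
by rewrite -[RHS]card_ord; apply: eq_card => i; rewrite !inE ffunE.
Qed.

Theorem proposition4p1 (R : realType) (d n r : nat) (beta : R)
  (hd : (2 <= d)%N) (hn : (2 <= n)%N) (hbeta : 0 < beta)
  (hr : (1 <= r <= d.-1)%N)
  (disp : R -> measure_display)
  (Omega : forall m : R, measurableType (disp m))
  (P : forall m : R, probability (Omega m) R)
  (g : forall m : R, lattice d n -> {RV (P m) >-> R})
  (hg : forall m : R, 0 < m -> is_gff (boundary d n r) beta m (g m)) :
  [/\ forall x x' : lattice d n,
        x \notin boundary d n r -> x' \notin boundary d n r ->
        covariance (P m) (g m x) (g m x') @[m --> 0^'+] -->
          (beta^-1 * ((x == x')%:R + (#|boundary d n r|%:R)^-1))%:E,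
      forall x x' : lattice d n,
        x \notin boundary d n r -> x' \notin boundary d n r -> x != x' ->
        correlation (P m) (g m x) (g m x') @[m --> 0^'+] -->
          ((1 + #|boundary d n r|%:R)^-1 : R) &
      forall b b' : nat, (b < b')%N ->
        (1 + b'%:R)^-1 < (1 + b%:R)^-1 :> R].
Proof.
have rd : (r < d)%N by case/andP: hr => _; case: (d) hd.
have B0 := boundary_gt0 d n r hn rd.
set b : R := #|_|%:R; have b0 : 0 < b by rewrite ltr0n.
pose V := gff_covariance beta (n%:R ^+ d) b.
have cov x x' m : x \notin boundary d n r -> x' \notin boundary d n r -> 0 < m ->
    covariance (P m) (g m x) (g m x') = (V (x == x')%:R m)%:E.
  by move=> xB x'B m0; apply: covariance_gff => //; [exact: ltnW|exact: hg].
have cvg_cov delta : V delta m @[m --> 0^'+] --> beta^-1 * (delta + b^-1).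
  exact: cvg_gff_covariance.
split=> [x x' xB x'B|x x' xB x'B xx'|k k' kk'].
- apply: cvg_EFin; first by near=> m; rewrite cov.
  apply: cvg_trans (cvg_cov (x == x')%:R).
  by apply: near_eq_cvg; near=> m; rewrite /= cov.
(* The limit as a quotient of the limiting covariance by the limiting variance, the cases delta = 0
   and delta = 1. *)
- have -> : (1 + b)^-1 = (beta^-1 * (0 + b^-1)) / (beta^-1 * (1 + b^-1)).
    by field; rewrite !gt_eqF // addr_gt0.
  have var_neq0 : beta^-1 * (1 + b^-1) != 0.
    by rewrite gt_eqF // mulr_gt0 ?invr_gt0 // addr_gt0 ?invr_gt0.
  apply: cvg_trans (cvgM (cvg_cov 0) (cvgV var_neq0 (cvg_cov 1))).
  apply: near_eq_cvg; near=> m.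
  have m0 : 0 < m by [].
  (* Both variances equal [V 1 m], so the product of their square roots is [V 1 m] itself. *)
  have V0 : 0 <= V 1 m by rewrite gff_covariance_ge0 // ltW // exprn_gt0 ?ltr0n // ltnW.
  rewrite /correlation /variance !cov // !eqxx (negbTE xx') /=.
  by rewrite -expr2 sqr_sqrtr.
- by rewrite ltf_pV2 ?posrE ?ltrD2l ?ltr_nat // ltr_wpDr.
Unshelve. all: by end_near. Qed.
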